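(* Suppose the potential outcomes satisfy the network latent factor model of rank $r$ described in the context, and that $\bar r=r$. Suppose that the coordinates satisfy $u_{k,n,\ell}\overset{\mathrm{iid}}{\sim}p_u$ and $w_{t,a,\ell}\overset{\mathrm{iid}}{\sim}p_w$ for all $k,n\in[N]$, $t\in[T]$, $a\in[D]$, $\ell\in[r]$, where $p_u$ and $p_w$ are continuous and non-degenerate (i.e., the laws of the resulting $r$-dimensional latent vectors are not supported on a set of dimension less than $r$). Let $n\in[N]$ be any unit and $\tilde a_{\mathcal N(n)}$ any target treatment. If TrainingTreatmentTest with hyperparameter $\bar r$ is passed (for $n$ and $\tilde a_{\mathcal N(n)}$), then almost surely the rowspace of $\mathbb E[Z_{\mathrm{pr},\mathcal I^{(n)}}\mid LF,A]$ lies within the rowspace of $\mathbb E[Z_{\mathrm{tr},\mathcal I^{(n)}}\mid LF,A]$.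
   Context: $[X]=\{1,\dots,X\}$. There are $N$ units, $D$ treatments, $T$ measurements. $\mathcal G=([N],\mathcal E)$ is a fixed, known undirected graph with all self-edges; $\mathcal N(n)=\{j:(j,n)\in\mathcal E\}\ni n$, with a fixed ordering. For $a\in[D]^N$, $a_S$ is the subvector indexed by $S$. Network latent factor model of rank $r$: for all $t\in[T]$, $n\in[N]$, $a\in[D]^N$ the potential outcome is $Y^{(a)}_{t,n}=Y^{(a_{\mathcal N(n)})}_{t,n}=\sum_{j\in\mathcal N(n)}\langle u_{j,n},w_{t,a_j}\rangle+\epsilon^{(a_{\mathcal N(n)})}_{t,n}$ with $u_{j,n},w_{t,b}\in\mathbb R^r$ (coordinates $u_{j,n,\ell}$, $w_{t,b,\ell}$), $\mathbb E[\epsilon^{(a_{\mathcal N(n)})}_{t,n}\mid LF]=0$, $LF=\{u_{j,i},w_{t,b}\}$. Data: $A=[a^1,\dots,a^T]\in[D]^{N\times T}$ is the treatment assignment; $Z_{t,n}=Y^{(a^t)}_{t,n}$, $Z\in\mathbb R^{T\times N}$. Potential outcomes are independent of $A$ given $LF$, so $\mathbb E[Z_{t,n}\mid LF,A]=\sum_{j\in\mathcal N(n)}\langle u_{j,n},w_{t,a^t_j}\rangle$. $\mathcal T_{\mathrm{tr}}=\{1,\dots,T_{\mathrm{tr}}\}$, $\mathcal T_{\mathrm{pr}}=\{T_{\mathrm{tr}}+1,\dots,T\}$; $a^t=a^{\mathrm{pr}}$ for all $t\in\mathcal T_{\mathrm{pr}}$. $M[S_1,S_2]$ is a submatrix. Given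 the target $\tilde a\in[D]^N$, the donor set $\mathcal I^{(n)}$ is the set of units $i\neq n$ with $|\mathcal N(i)|=|\mathcal N(n)|$ for which there is a permutation $\pi_i$ of $\mathcal N(i)$ with $A[\pi_i(\mathcal N(i)),\mathcal T_{\mathrm{tr}}]=A[\mathcal N(n),\mathcal T_{\mathrm{tr}}]$ and $a^{\mathrm{pr}}_{\pi_i(\mathcal N(i))}=\tilde a_{\mathcal N(n)}$. $Z_{\mathrm{tr},\mathcal I}=Z[\mathcal T_{\mathrm{tr}},\mathcal I]$, $Z_{\mathrm{pr},\mathcal I}=Z[\mathcal T_{\mathrm{pr}},\mathcal I]$. TrainingTreatmentTest (hyperparameter $\bar r\in\mathbb N_{>0}$): for $a\in[D]$ let $B^{\mathrm{tr}}(a)\in\{0,1\}^{N\times T_{\mathrm{tr}}}$ have entries $\mathbf 1(A_{it}=a)$ and $\tilde b(a)\in\{0,1\}^N$ have entries $\mathbf 1(\tilde a_i=a)$; let $B^{\mathrm{tr}}=[B^{\mathrm{tr}}(1),\dots,B^{\mathrm{tr}}(D)]$ and $\tilde B^{\mathrm{pr}}=[\tilde b(1),\dots,\tilde b(D)]$. The test is passed for $n,\tilde a_{\mathcal N(n)}$ if (i) $\mathrm{columnspace}(\tilde B^{\mathrm{pr}}[\mathcal N(n),:])\subseteq\mathrm{columnspace}(B^{\mathrm{tr}}[\mathcal N(n),:])$, and (ii) for every $t\in\mathcal T_{\mathrm{tr}}$ the treatment vector $A[\mathcal N(n),t]$ occurs for at least $\bar rD$ of the measurements in $\mathcal T_{\mathrm{tr}}$.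 *)

(* Defs.v *)
(* MathComp / MathComp-Analysis development. *)
From HB Require Import structures.
From mathcomp Require Import all_boot all_order all_algebra.
From mathcomp Require Import all_classical all_reals all_analysis.

Set Implicit Arguments.
Unset Strict Implicit.
Unset Printing Implicit Defensive.
Import Order.TTheory GRing.Theory Num.Theory.
Import numFieldNormedType.Exports.

Local Open Scope classical_set_scope.
Local Open Scope ring_scope.

(* [N] = {1, ..., N} is rendered by 'I_N, and similarly for treatments and
   measurements.  Measurements are 'I_(Ttr + Tpr): the training ones come first,
   so the training/prediction blocks are given by lsubmx/rsubmx (columns) and
   usubmx/dsubmx (rows). *)

(** * Probability *)

(* A sub-sigma-algebra of Om is given by its collection of events. *)
Definition preimages (Om : Type) (R : realType) (I : Type) (X : I -> Om -> R) :
    set (set Om) :=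
  \bigcup_i preimage_set_system [set: Om] (X i) measurable.

(* [M] is a version of E[X | G], for G a sub-sigma-algebra.  X is only required
   to be sigma-integrable over G (Om is a countable union of events of G on which
   X is integrable), so that the conditional expectation makes sense even if
   the G-measurable part of X has no moment.  For an integrable X this is the
   textbook definition. *)
Definition is_condexp (d : measure_display) (Om : measurableType d)
    (R : realType) (P : probability Om R) (G : set (set Om)) (X M : Om -> R) :=
  [/\ forall C : set R, measurable C -> G (M @^-1` C),
      exists B : nat -> set Om,
        [/\ forall k, G (B k), \bigcup_k B k = [set: Om] &
            forall k, P.-integrable (B k) (EFin \o X)] &
      forall B : set Om, G B -> P.-integrable B (EFin \o X) ->
        P.-integrable B (EFin \o M) /\
        (\int[P]_(x in B) (M x)%:E = \int[P]_(x in B) (X x)%:E)%E].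

(* Conditional independence of H1 and H2 given G:
   P(E `&` F | G) = P(E | G) P(F | G) for all E in H1 and F in H2. *)
Definition cond_indep (d : measure_display) (Om : measurableType d)
    (R : realType) (P : probability Om R) (G H1 H2 : set (set Om)) :=
  forall E F : set Om, H1 E -> H2 F ->
    exists p q : Om -> R,
      [/\ is_condexp P G (\1_E) p, is_condexp P G (\1_F) q &
          is_condexp P G (\1_(E `&` F)) (fun x => p x * q x)].

Definition mutual_indep (d : measure_display) (Om : measurableType d)
    (R : realType) (P : probability Om R) (I : finType)
    (X : I -> {RV P >-> R}) :=
  forall (J : {set I}) (C : I -> set R), (forall i, measurable (C i)) ->
    P (\bigcap_(i in [set` J]) (X i @^-1` C i))
    = (\prod_(i in J) P (X i @^-1` C i))%E.

Definition iid (d : measure_display) (Om : measurableType d)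
    (R : realType) (P : probability Om R) (I : finType)
    (X : I -> {RV P >-> R}) (p : probability R R) :=
  mutual_indep X /\
  forall i (C : set R), measurable C -> distribution P (X i) C = p C.

(* Continuity of a law on R, i.e. of its distribution function: no atoms. *)
Definition continuous_law (R : realType) (p : probability R R) :=
  forall x : R, p [set x] = 0%E.

(* The law of the random vector X is not supported on an affine subspace
   v + rowspace(V) of dimension less than r. *)
Definition nondegenerate_vector (d : measure_display) (Om : measurableType d)
    (R : realType) (P : probability Om R) (r : nat) (X : Om -> 'rV[R]_r) :=
  forall (v : 'rV[R]_r) (V : 'M[R]_r), (\rank V < r)%N ->
    ~ {ae P, forall om, (X om - v <= V)%MS}.

(** * Network, donors, test *)

Definition nbhd (N : nat) (e : rel 'I_N) (n : 'I_N) : {set 'I_N} :=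
  [set j | e j n]%SET.

(* M[S, :] and M[:, S]; the fixed ordering of a set of units is the one of enum. *)
Definition sub_rows (T : Type) (N m : nat) (S : {set 'I_N}) (M : 'M[T]_(N, m)) :
    'M[T]_(#|S|, m) :=
  rowsub (fun k : 'I_#|S| => enum_val k) M.

Definition sub_cols (T : Type) (m N : nat) (S : {set 'I_N}) (M : 'M[T]_(m, N)) :
    'M[T]_(m, #|S|) :=
  colsub (fun k : 'I_#|S| => enum_val k) M.

(* A[s, :] for an ordered list of units s. *)
Definition rows_of (N D m : nat) (A : 'M['I_D]_(N, m)) (s : seq 'I_N) :
    seq 'rV['I_D]_m :=
  [seq row j A | j <- s].

(* The list [s] below is the permuted neighborhood pi_i(N(i)). *)
Definition donors (N D Ttr : nat) (e : rel 'I_N) (Atr : 'M['I_D]_(N, Ttr))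
    (apr atilde : 'cV['I_D]_N) (n : 'I_N) : {set 'I_N} :=
  [set i | [&& i != n, #|nbhd e i| == #|nbhd e n| &
     has (fun s => (rows_of Atr s == rows_of Atr (enum (nbhd e n))) &&
                   (rows_of apr s == rows_of atilde (enum (nbhd e n))))
         (permutations (enum (nbhd e i)))]]%SET.

Definition Btr (R : realType) (N D Ttr : nat) (Atr : 'M['I_D]_(N, Ttr)) :
    'M[R]_(N, \sum_(b < D) Ttr) :=
  \mxrow_(b < D) (\matrix_(i < N, t < Ttr) (Atr i t == b)%:R).

Definition Bpr (R : realType) (N D : nat) (atilde : 'cV['I_D]_N) : 'M[R]_(N, D) :=
  \matrix_(i < N, b < D) (atilde i ord0 == b)%:R.

Definition training_treatment_test (R : realType) (N D Ttr : nat) (rbar : nat)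
    (e : rel 'I_N) (Atr : 'M['I_D]_(N, Ttr)) (atilde : 'cV['I_D]_N)
    (n : 'I_N) : bool :=
  ((sub_rows (nbhd e n) (Bpr R atilde))^T <=
   (sub_rows (nbhd e n) (Btr R Atr))^T)%MS &&
  [forall t : 'I_Ttr,
    (rbar * D <= #|[set s : 'I_Ttr | col s (sub_rows (nbhd e n) Atr)
                                  == col t (sub_rows (nbhd e n) Atr)]%SET|)%N].

(** * Latent factors and observations *)

(* u (j, n, l) and w (t, b, l) are the coordinates of u_{j,n} and w_{t,b}. *)
Definition gen_LF (d : measure_display) (Om : measurableType d) (R : realType)
    (P : probability Om R) (N D T r : nat)
    (u : 'I_N * 'I_N * 'I_r -> {RV P >-> R})
    (w : 'I_T * 'I_D * 'I_r -> {RV P >-> R}) : set (set Om) :=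
  preimages (fun i => u i : Om -> R) `|` preimages (fun i => w i : Om -> R).

Definition events_of (Om X : Type) (A : Om -> X) : set (set Om) :=
  [set A @^-1` S | S in [set: set X]].

(* Y (a, t, n) is the potential outcome of unit n at measurement t under the
   assignment a; column t of A is the assignment of measurement t. *)
Definition observed (d : measure_display) (Om : measurableType d) (R : realType)
    (P : probability Om R) (N D T : nat)
    (Y : 'cV['I_D]_N * 'I_T * 'I_N -> {RV P >-> R})
    (A : Om -> 'M['I_D]_(N, T)) (om : Om) : 'M[R]_(T, N) :=
  \matrix_(t < T, n < N) Y (col t (A om), t, n) om.

(* Y_{t,n}^(a) = sum_{j in N(n)} <u_{j,n}, w_{t,a_j}> + eps_{t,n}^(a), the noise
   depending on a only through a_{N(n)} and being centered given LF. *)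
Definition network_latent_factor_model (d : measure_display)
    (Om : measurableType d) (R : realType) (P : probability Om R)
    (N D T r : nat) (e : rel 'I_N)
    (u : 'I_N * 'I_N * 'I_r -> {RV P >-> R})
    (w : 'I_T * 'I_D * 'I_r -> {RV P >-> R})
    (Y eps : 'cV['I_D]_N * 'I_T * 'I_N -> {RV P >-> R}) :=
  [/\ forall (a : 'cV['I_D]_N) t n om,
        Y (a, t, n) om =
        \sum_(j in nbhd e n) \sum_(l < r) u (j, n, l) om * w (t, a j ord0, l) om
        + eps (a, t, n) om,
      forall (a a' : 'cV['I_D]_N) t n, (forall j, j \in nbhd e n -> a j ord0 = a' j ord0) ->
        forall om, eps (a, t, n) om = eps (a', t, n) om &
      forall a t n, is_condexp P <<s gen_LF u w >> (eps (a, t, n)) (cst 0)].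

(* Main.v *)
Require Import Defs.
From HB Require Import structures.
From mathcomp Require Import all_boot all_order all_algebra.
From mathcomp Require Import all_classical all_reals all_analysis.
From mathcomp Require Import finmap lra measurable_realfun.
Set Implicit Arguments.
Unset Strict Implicit.
Unset Printing Implicit Defensive.
Import Order.TTheory GRing.Theory Num.Theory.
Import numFieldNormedType.Exports.
Local Open Scope classical_set_scope.
Local Open Scope ring_scope.

(** Almost surely E[Z_{t,i} | LF, A] is the model mean, the sum over j in N(i) of
    <u_{j,i}, w_{t,a^t_j}>: conditioning on A as well as on LF leaves the noise
    centered, by conditional independence.  For a donor i, reindexing N(i) by the
    permutation pi_i turns this mean into U_i . x_t, where U_i collects the vectors
    u_{pi_i(k),i} and x_t = (w_{t,A(k,t)})_k, k in N(n), does not depend on i.  So it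
    suffices that the target x_t lie in the span of the training ones.  A training
    pattern repeated at least rD times spans everything of the form
    (q_{A(k,t)})_k, because rD of the vectors (w_{t,b})_b in R^{rD} have a nonzero
    determinant almost surely; the columnspace inclusion of the test then writes the
    target as a sum of such vectors.  Since A may depend on LF, the determinants
    are controlled simultaneously for all choices of rD training measurements. *)

(** * Integrals over sub-sigma-algebras *)

Section sub_sigma_algebra.
Context d (T : measurableType d) (R : realType).
Variable G : set (set T).
Hypothesis Gmeas : G `<=` measurable.

Lemma g_sigma_sub_measurable : <<s G >> `<=` measurable.
Proof. by apply: smallest_sub Gmeas; exact: sigma_algebra_measurable. Qed.

Definition adapted (f : T -> R) := measurable_fun [set: g_sigma_algebraType G] f.

Lemma adaptedP (f : T -> R) :
  adapted f <-> forall C : set R, measurable C -> <<s G >> (f @^-1` C).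
Proof.
split=> [mf C mC|mf _ C mC]; first by rewrite -[X in <<s G >> X]setTI; exact: mf.
by rewrite setTI; exact: mf.
Qed.

Lemma adapted_measurable (f : T -> R) : adapted f -> measurable_fun setT f.
Proof. by move=> mf mT C mC; apply: g_sigma_sub_measurable; exact: mf. Qed.

Lemma g_sigmaI (A B : set T) : <<s G >> A -> <<s G >> B -> <<s G >> (A `&` B).
Proof.
exact: (@measurableI _ (g_sigma_algebraType G)).
Qed.

Variable mu : {measure set T -> \bar R}.
Import HBNNSimple.

(** The factor [\1_A] only cuts [B] down to another event of [<<s G>>]. This is the simple-function
    case of the multiplier lemmas below. *)
Lemma integral_indic_mul_eq0 (B A : set T) (X : T -> R) (y : R) :
  <<s G >> B -> <<s G >> A -> mu.-integrable B (EFin \o X) ->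
  (forall H, <<s G >> H -> H `<=` B -> (\int[mu]_(x in H) (X x)%:E = 0)%E) ->
  mu.-integrable B (fun x => (y * \1_A x * X x)%:E) /\
  (\int[mu]_(x in B) (y * \1_A x * X x)%:E = 0)%E.
Proof.
move=> GB GA iX X0.
have mB : measurable B by exact: g_sigma_sub_measurable.
have mA : measurable A by exact: g_sigma_sub_measurable.
have E x : (y * \1_A x * X x)%:E = (y%:E * ((EFin \o X) \_ A) x)%E.
  rewrite patchE /= indicE; case: ifP => xA; first by rewrite mulr1 EFinM.
  by rewrite mulr0 mul0r mule0.
have iXA : mu.-integrable B ((EFin \o X) \_ A).
  rewrite -integrable_restrict//.
  by apply: integrableS iX => //; exact: measurableI.
rewrite (funext E); split; first exact: integrableZl.
rewrite integralZl// -integral_mkcondr X0 ?mule0//; first exact: g_sigmaI.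
Qed.

(** Simple functions increase to [f] and [|f X|] dominates the products, so the simple case passes
    to the limit. *)
Lemma integral_mul_eq0_ge0 (B : set T) (X f : T -> R) :
  <<s G >> B -> mu.-integrable B (EFin \o X) ->
  (forall H, <<s G >> H -> H `<=` B -> (\int[mu]_(x in H) (X x)%:E = 0)%E) ->
  adapted f -> (forall x, 0 <= f x) ->
  mu.-integrable B (fun x => (f x * X x)%:E) ->
  (\int[mu]_(x in B) (f x * X x)%:E = 0)%E.
Proof.
move=> GB iX X0 af f0 ifX.
have mB : measurable B by exact: g_sigma_sub_measurable.
have /measurable_EFinP mef := af.
(* The approximation lives on the space carrying [<<s G>>], so the level sets of each [g n] are
   events of [<<s G>>]. *)
pose g := nnsfun_approx (@measurableT _ (g_sigma_algebraType G)) mef.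
have ef0 t : [set: g_sigma_algebraType G] t -> (0 <= (f t)%:E)%E.
  by rewrite lee_fin.
have gf x : EFin \o g ^~ x @ \oo --> (f x)%:E by exact: cvg_nnsfun_approx.
have g_le n x : g n x <= f x.
  by rewrite /g nnsfun_approxE -lee_fin; exact: (@le_approx _ _ _ setT (EFin \o f)).
have mg n : measurable_fun setT (g n : T -> R).
  by apply: adapted_measurable; exact: measurable_funPT.
have mX : measurable_fun B X by exact/measurable_EFinP/measurable_int/iX.
have mgX n : measurable_fun B (fun x => (g n x * X x)%:E).
  by apply/measurable_EFinP/measurable_funM => //; exact: measurable_funTS.
have gXE n x : (g n x * X x)%:E = (\sum_(y <- fset_set (range (g n)))
    (y * \1_((g n : T -> R) @^-1` [set y]) x * X x)%:E)%E.
  rewrite sumEFin -mulr_suml {1}fimfunE fsbig_finite//.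
have Gg n y : <<s G >> ((g n : T -> R) @^-1` [set y]).
  apply: (adaptedP _).1; [exact: measurable_funPT | exact: measurable_set1].
have g0 n : (\int[mu]_(x in B) (g n x * X x)%:E = 0)%E.
  under eq_integral => x _ do rewrite gXE.
  rewrite integral_sum//.
    by rewrite big1// => y _; exact: (integral_indic_mul_eq0 _ _ (Gg n y) _ _).2.
  by move=> y; exact: (integral_indic_mul_eq0 _ _ (Gg n y) _ _).1.
have [|||_ _] := @dominated_convergence _ _ _ mu B mB
  (fun n x => (g n x * X x)%:E) (fun x => (f x * X x)%:E)
  (fun x => `|(f x * X x)%:E|%E) mgX (measurable_int _ ifX).
- apply: aeW => x _; rewrite EFinM; under eq_fun do rewrite EFinM.
  by apply: cvgeZr => //; exact: gf.
- exact: integrable_abse.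
- apply: aeW => x n _; rewrite lee_fin !normrM ler_wpM2r//.
  by rewrite !ger0_norm.
- by under eq_fun do rewrite g0; move=> /(cvg_unique _ (cvg_cst 0%E)) <-.
Qed.

(** The pull-out property for a centered [X]. Integrability of the product stands in for boundedness
    of [f]; positive and negative parts reduce to the previous case. *)
Lemma integral_mul_eq0 (B : set T) (X f : T -> R) :
  <<s G >> B -> mu.-integrable B (EFin \o X) ->
  (forall H, <<s G >> H -> H `<=` B -> (\int[mu]_(x in H) (X x)%:E = 0)%E) ->
  adapted f -> mu.-integrable B (fun x => (f x * X x)%:E) ->
  (\int[mu]_(x in B) (f x * X x)%:E = 0)%E.
Proof.
move=> GB iX X0 af ifX.
have mB : measurable B by exact: g_sigma_sub_measurable.
have mX : measurable_fun B X by exact/measurable_EFinP/measurable_int/iX.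
have part h : adapted h -> (forall x, `|h x| <= `|f x|) ->
    mu.-integrable B (fun x => (h x * X x)%:E).
  move=> ah hf; apply: le_integrable ifX => //.
    apply/measurable_EFinP/measurable_funM => //.
    exact/measurable_funTS/adapted_measurable.
  by move=> x _; rewrite lee_fin !normrM ler_wpM2r.
have ap : adapted f^\+ by exact: measurable_funrpos.
have an : adapted f^\- by exact: measurable_funrneg.
have ip : mu.-integrable B (fun x => (f^\+ x * X x)%:E).
  apply: part => // x; rewrite /funrpos ger0_norm ?le_max ?lexx ?orbT//.
  by rewrite ge_max ler_norm normr_ge0.
have i_n : mu.-integrable B (fun x => (f^\- x * X x)%:E).
  apply: part => // x; rewrite /funrneg ger0_norm ?le_max ?lexx ?orbT//.
  by rewrite ge_max -normrN ler_norm normr_ge0.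
transitivity (\int[mu]_(x in B) ((f^\+ x * X x)%:E - (f^\- x * X x)%:E))%E.
  by apply: eq_integral => x _; rewrite -EFinB -mulrBl -[in LHS](funrposBneg f).
rewrite integralB// !integral_mul_eq0_ge0 ?sube0//.
Qed.

(** Serves as uniqueness of conditional expectations, localized to an event [B]. *)
Lemma adapted_int_eq0_ae (B : set T) (X : T -> R) :
  <<s G >> B -> mu.-integrable B (EFin \o X) -> adapted X ->
  (forall H, <<s G >> H -> H `<=` B -> (\int[mu]_(x in H) (X x)%:E = 0)%E) ->
  {ae mu, forall x, B x -> X x = 0}.
Proof.
move=> GB iX aX X0.
have mB : measurable B by exact: g_sigma_sub_measurable.
(* The multiplier [sg X] turns the hypothesis into \int |X| = 0. *)
have aS : adapted (Num.sg \o X).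
  have sg_mono : {homo Num.sg : x y / x <= y :> R}.
    by move=> x y; case: (sgrP x); case: (sgrP y) => //; lra.
  apply: measurableT_comp aX.
  exact: nondecreasing_measurable.
have sgE x : (Num.sg (X x) * X x)%:E = `|(X x)%:E|%E by rewrite -normrEsg.
have := integral_mul_eq0 GB iX X0 aS.
under [X in integrable _ _ X]eq_fun do rewrite /= sgE.
under eq_integral do rewrite /= sgE.
move=> /(_ (integrable_abse iX)) /ae_eq_integral_abs.
move=> /(_ mB (measurable_int _ iX)).
by apply: filterS => x /[apply] -[].
Qed.
End sub_sigma_algebra.

(** * Restriction to an event and the pi-lambda argument *)

Section indic.
Context d (T : measurableType d) (R : realType) (mu : {measure set T -> \bar R}).
Implicit Types (A B : set T) (f : T -> R).

Lemma mul_indic_patch f A : (fun x => (f x * \1_A x)%:E) = (EFin \o f) \_ A.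
Proof.
by apply/funext => x; rewrite patchE /= indicE; case: ifP; rewrite ?mulr1 ?mulr0.
Qed.

Lemma integral_mul_indic B A f :
  (\int[mu]_(x in B) (f x * \1_A x)%:E = \int[mu]_(x in B `&` A) (f x)%:E)%E.
Proof. by rewrite mul_indic_patch -integral_mkcondr. Qed.

Lemma integrable_mul_indic B A f : measurable B -> measurable A ->
  mu.-integrable B (EFin \o f) -> mu.-integrable B (fun x => (f x * \1_A x)%:E).
Proof.
move=> mB mA iX; rewrite mul_indic_patch -integrable_restrict//.
by apply: integrableS iX => //; exact: measurableI.
Qed.

Lemma integrable_subr A f g : measurable A ->
  mu.-integrable A (EFin \o f) -> mu.-integrable A (EFin \o g) ->
  mu.-integrable A (EFin \o (fun x => f x - g x)).
Proof.
move=> mA iF ig; rewrite (_ : _ \o _ = (EFin \o f) \- (EFin \o g))%E; last first.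
  by apply/funext => x /=; rewrite EFinB.
exact: integrableB.
Qed.

Lemma integral_subr_eq0 A f g : measurable A ->
  mu.-integrable A (EFin \o f) -> mu.-integrable A (EFin \o g) ->
  (\int[mu]_(x in A) (f x)%:E = \int[mu]_(x in A) (g x)%:E)%E <->
  (\int[mu]_(x in A) (f x - g x)%:E = 0)%E.
Proof.
move=> mA iF ig; under [X in _ <-> X = _]eq_integral do rewrite EFinB.
rewrite (integralB mA iF ig); split => [->|/eqP].
  by rewrite subee//; exact: integrable_fin_num.
by rewrite sube_eq ?add0e => [/eqP->//||];
  rewrite ?fin_num_adde_defl ?integrable_fin_num.
Qed.

(** The measurable sets over which [X] integrates to 0 form a lambda-system: the zero total integral
    handles complements, countable additivity handles disjoint unions. *)
Lemma integral_eq0_g_sigma (C : set (set T)) (X : T -> R) :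
  C `<=` measurable -> setI_closed C -> mu.-integrable setT (EFin \o X) ->
  (\int[mu]_x (X x)%:E = 0)%E ->
  (forall A, C A -> (\int[mu]_(x in A) (X x)%:E = 0)%E) ->
  forall A, <<s C >> A -> (\int[mu]_(x in A) (X x)%:E = 0)%E.
Proof.
move=> Cm CI iX X0 CX A CA.
pose H := [set A | measurable A /\ (\int[mu]_(x in A) (X x)%:E = 0)%E].
suff : H A by case.
apply: (@lambda_system_subset _ C CI setT H _ _ _ A CA) => //.
- apply/dynkin_lambda_system; split => //.
  + move=> B [mB B0]; split; first exact: measurableC.
    have := X0; rewrite -(setUv B) integral_setU_EFin//=.
    * by rewrite B0 add0e.
    * exact: measurableC.
    * by apply: measurable_funTS; exact/measurable_EFinP/measurable_int/iX.
    * exact/disj_setPCl.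
  + move=> F tF HF; have mF n : measurable (F n) by case: (HF n).
    split; first exact: bigcupT_measurable.
    rewrite integral_bigcup//.
      by rewrite eseries0// => n _ _; case: (HF n).
    by apply: integrableS iX => //; exact: bigcupT_measurable.
- by move=> B CB; split; [exact: Cm|exact: CX].
Qed.

End indic.

(** * Centered noise under conditional independence *)

Section conditional_independence.
Context d (T : measurableType d) (R : realType) (P : probability T R).
Variables (G Y : set (set T)) (HA : set (set T)).
Hypotheses (Gm : G `<=` measurable) (Ym : Y `<=` measurable).
Hypothesis HAm : HA `<=` measurable.
Hypothesis indep : cond_indep P <<s G>> <<s Y>> HA.

(** A pi-system generating the join of [<<s G>>] and [<<s Y>>], on which integral identities can be
    tested. *)
Let GY := [set E `&` B | E in <<s Y>> & B in <<s G>>].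

Lemma setI_gen_measurable : GY `<=` measurable.
Proof.
move=> _ [E YE [B GB <-]]; apply: measurableI.
- exact: g_sigma_sub_measurable YE.
- exact: g_sigma_sub_measurable GB.
Qed.

Lemma setI_gen_closed : setI_closed GY.
Proof.
move=> _ _ [E1 Y1 [B1 G1 <-]] [E2 Y2 [B2 G2 <-]].
exists (E1 `&` E2); first exact: g_sigmaI.
by exists (B1 `&` B2); [exact: g_sigmaI|rewrite setIACA].
Qed.

Let integrable_ind (E B : set T) : measurable E -> measurable B ->
  P.-integrable B (EFin \o \1_E).
Proof. 
move=> mE mB; apply: (integrableS measurableT) => //.
exact: integrable_indic.
Qed.

(* [q] is a version of P(F | G), and still one of P(F | G, Y). *)
Lemma cond_indep_density F : HA F -> exists q : T -> R,
  [/\ adapted G q, P.-integrable setT (EFin \o q) &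
      forall K, <<s GY>> K -> (\int[P]_(x in K) (\1_F x - q x)%:E = 0)%E].
Proof.
move=> AF; have mF := HAm AF.
have YT : <<s Y>> setT by exact: (@measurableT _ (g_sigma_algebraType Y)).
have GT : <<s G>> setT by exact: (@measurableT _ (g_sigma_algebraType G)).
(* Taking [setT] as the first event yields one [q], fixed before any [E]. *)
have [_ [q [_ [aq _ qF] _]]] := indep YT AF.
have [iq _] := qF _ GT (integrable_ind mF measurableT).
exists q; split=> //; first exact/adaptedP.
have iX : P.-integrable setT (EFin \o (fun x => \1_F x - q x)).
  by apply: integrable_subr => //; exact: integrable_ind.
have int_q K : <<s G>> K ->
    (\int[P]_(x in K) (q x)%:E = \int[P]_(x in K) (\1_F x)%:E)%E.
  by move=> GK; rewrite (qF _ GK _).2//; apply: integrable_ind => //;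
    exact: g_sigma_sub_measurable GK.
apply: integral_eq0_g_sigma => //.
- exact: setI_gen_measurable.
- exact: setI_gen_closed.
- apply/integral_subr_eq0 => //; first exact: integrable_ind.
  by rewrite int_q.
move=> _ [E YE [B GB <-]].
have mE : measurable E by exact: g_sigma_sub_measurable YE.
have mB : measurable B by exact: g_sigma_sub_measurable GB.
(* The version [q'] supplied here depends on [E]; uniqueness makes it agree almost surely with
   [q]. *)
have [p [q' [[ap _ pE] [aq' _ q'F] [_ _ pq]]]] := indep YE AF.
have [iq' _] := q'F _ GT (integrable_ind mF measurableT).
have [ip _] := pE _ GT (integrable_ind mE measurableT).
have mEF : measurable (E `&` F) by exact: measurableI.
have int_q' K : <<s G>> K ->
    (\int[P]_(x in K) (q' x)%:E = \int[P]_(x in K) (\1_F x)%:E)%E.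
  by move=> GK; rewrite (q'F _ GK _).2//; apply: integrable_ind => //;
    exact: g_sigma_sub_measurable GK.
have qq' : {ae P, forall x, setT x -> q x - q' x = 0}.
  apply: (adapted_int_eq0_ae Gm GT).
  - exact: integrable_subr.
  - by apply: measurable_funB; exact/adaptedP.
  - move=> K GK _.
    have mK : measurable K by exact: g_sigma_sub_measurable GK.
    apply/integral_subr_eq0 => //.
    + exact: integrableS iq.
    + exact: integrableS iq'.
    + by rewrite int_q// int_q'.
have [ipq pqE] := pq _ GB (integrable_ind mEF mB).
have iq'B : P.-integrable B (EFin \o q') by exact: integrableS iq'.
have iq'E := integrable_mul_indic mB mE iq'B.
(* Pull-out with multiplier [q'], since [\1_E - p] is centered given [G]. *)
have pq0 : (\int[P]_(x in B) (q' x * (\1_E x - p x))%:E = 0)%E.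
  apply: (integral_mul_eq0 Gm GB).
  - apply: integrable_subr => //; first exact: integrable_ind.
    exact: integrableS ip.
  - move=> K GK _.
    have mK : measurable K by exact: g_sigma_sub_measurable GK.
    apply/integral_subr_eq0 => //.
    + exact: integrable_ind.
    + exact: integrableS ip.
    + by rewrite (pE _ GK _).2//; exact: integrable_ind.
  - exact/adaptedP.
  - apply: eq_integrable (integrable_subr mB iq'E ipq) => //.
    by move=> x _ /=; rewrite mulrBr (mulrC (p x)).
have mEB : measurable (E `&` B) by exact: measurableI.
apply/integral_subr_eq0 => //.
- exact: integrable_ind.
- exact: integrableS iq.
(* Over [B], the integral of [\1_E \1_F] becomes that of [p q'], then of [q' \1_E], then of
   [q \1_E]. *)
rewrite setIC -!integral_mul_indic.
transitivity (\int[P]_(x in B) (p x * q' x)%:E)%E.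
  by rewrite pqE; apply: eq_integral => x _; rewrite indicI mulrC.
transitivity (\int[P]_(x in B) (q' x * \1_E x)%:E)%E.
  apply/esym/integral_subr_eq0 => //.
  rewrite -[RHS]pq0; apply: eq_integral => x _.
  by rewrite mulrBr (mulrC (p x)).
apply: ae_eq_integral => //.
- exact: measurable_int iq'E.
- apply: measurable_int (integrable_mul_indic mB mE _).
  exact: integrableS iq.
- by apply: filterS qq' => x /(_ I) /subr0_eq ->.
Qed.

(** Two pull-outs: [\1_F] is replaced by [q] with [eps] as multiplier for the join, then [q] is the
    multiplier of a noise centered given [G]. *)
Lemma cond_indep_integral_eq0 F B (eps : T -> R) :
  HA F -> <<s G>> B -> adapted GY eps -> P.-integrable B (EFin \o eps) ->
  (forall K, <<s G>> K -> K `<=` B -> (\int[P]_(x in K) (eps x)%:E = 0)%E) ->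
  (\int[P]_(x in B `&` F) (eps x)%:E = 0)%E.
Proof.
move=> AF GB aeps ieps eps0.
have mF := HAm AF.
have mB : measurable B by exact: g_sigma_sub_measurable GB.
have [q [aq iq qF]] := cond_indep_density AF.
have YT : <<s Y>> setT by exact: (@measurableT _ (g_sigma_algebraType Y)).
have GGY : <<s G>> `<=` <<s GY>>.
  move=> K GK; apply: sub_sigma_algebra; exists setT => //.
  by exists K => //; rewrite setTI.
(* [q] is bounded on each level set [L l], so that [q * eps] is integrable there. *)
pose L (l : nat) := (fun x => Num.truncn `|q x|) @^-1` [set l].
have GL l : <<s G>> (L l).
  rewrite (_ : L l = (fun x => `|q x|) @^-1` `[l%:R, l.+1%:R[%classic).
    apply: (adaptedP _ _).1; last exact: measurable_itv.
    exact: measurableT_comp aq.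
  apply/seteqP; split => x; rewrite /L /= in_itv /=.
    by move=> /eqP; rewrite truncn_eq.
  by move=> xl; apply/eqP; rewrite truncn_eq.
have mL l : measurable (L l) by exact: g_sigma_sub_measurable (GL l).
have mBL l : measurable (B `&` L l) by exact: measurableI.
have BLF0 l : (\int[P]_(x in (B `&` L l) `&` F) (eps x)%:E = 0)%E.
  have GBL : <<s G>> (B `&` L l) by exact: g_sigmaI.
  have iepsL : P.-integrable (B `&` L l) (EFin \o eps).
    by apply: integrableS ieps.
  have iqeps : P.-integrable (B `&` L l) (fun x => (q x * eps x)%:E).
    apply: le_integrable (integrableZl _ l.+1%:R iepsL) => //.
      apply/measurable_EFinP/measurable_funM.
        by apply: measurable_funTS; exact: adapted_measurable aq.
      exact/measurable_EFinP/measurable_int/iepsL.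
    move=> x [_ Lx]; rewrite lee_fin !normrM ler_wpM2r// [leRHS]ger0_norm//.
    have : Num.truncn `|q x| == l by apply/eqP.
    by rewrite truncn_eq// => /andP[_ /ltW].
  have ieF : P.-integrable (B `&` L l) (fun x => (eps x * \1_F x)%:E).
    exact: integrable_mul_indic.
  have qe0 : (\int[P]_(x in B `&` L l) (q x * eps x)%:E = 0)%E.
    apply: (integral_mul_eq0 Gm) => // K GK KB; apply: eps0 => //.
    by move=> x /KB[].
  have e0 : (\int[P]_(x in B `&` L l) (eps x * (\1_F x - q x))%:E = 0)%E.
    apply: (integral_mul_eq0 setI_gen_measurable) => //.
    - exact: GGY.
    - apply: integrable_subr => //; first exact: integrable_ind.
      exact: integrableS iq.
    - by move=> K GK _; exact: qF.
    - apply: eq_integrable (integrable_subr (mBL l) ieF iqeps) => //.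
      by move=> x _ /=; rewrite mulrBr (mulrC (q x)).
  rewrite -integral_mul_indic -[RHS]qe0; apply/integral_subr_eq0 => //.
  rewrite -[RHS]e0; apply: eq_integral => x _.
  by rewrite mulrBr (mulrC (q x)).
have BFE : B `&` F = \bigcup_l ((B `&` L l) `&` F).
  apply/seteqP; split => [x [Bx Fx]|x [l _ [[Bx _] Fx]]]; last by split.
  by exists (Num.truncn `|q x|).
rewrite BFE integral_bigcup.
- by rewrite eseries0.
- move=> i j _ _ [x [[[_ xi] _] [[_ xj] _]]].
  by rewrite -xi -xj.
- by move=> l; exact: measurableI.
- by rewrite -BFE; apply: integrableS ieps => //; exact: measurableI.
Qed.
End conditional_independence.

(** * Conditioning on the assignment *)

Section conditional_expectation.
Context d (T : measurableType d) (R : realType) (P : probability T R).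
Context (V : Type) (A : T -> V) (G Y : set (set T)).
Hypotheses (Gm : G `<=` measurable) (Ym : Y `<=` measurable).
Hypothesis Am : events_of A `<=` measurable.
Hypothesis indep : cond_indep P <<s G>> <<s Y>> (events_of A).

(** On [A = a] an event of [A] is everything or nothing, so it has the trace of [setT] or [set0].
    The sets whose trace comes from [<<s G>>] form a sigma-algebra. *)
Lemma g_sigma_trace (H : set T) (a : V) : <<s G `|` events_of A>> H ->
  exists2 B, <<s G>> B & H `&` A @^-1` [set a] = B `&` A @^-1` [set a].
Proof.
set F := A @^-1` [set a].
pose S : set (set T) := [set H | exists2 B, <<s G>> B & H `&` F = B `&` F].
suff : <<s G `|` events_of A>> `<=` S by apply.
apply: smallest_sub; first split.
- by exists set0 => //; exact: sigma_algebra0.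
- move=> K [B GB KB]; exists (~` B).
    exact: (@measurableC _ (g_sigma_algebraType G)).
  rewrite setTD; apply/seteqP; split=> x [nx Fx]; split=> // Hx; apply: nx.
    by have [] : (K `&` F) x by rewrite KB.
  by have [] : (B `&` F) x by rewrite -KB.
- move=> K SK; have {SK}/choice[B SB] n : exists B, <<s G>> B /\ K n `&` F = B `&` F.
    by have [B GB KB] := SK n; exists B.
  exists (\bigcup_n B n).
    by apply: sigma_algebra_bigcup => n; have [] := SB n.
  rewrite !setI_bigcupl; apply: eq_bigcupr => n _; exact: (SB n).2.
- move=> K [GK|[C _ <-]]; first by exists K => //; exact: sub_sigma_algebra.
  have [Ca|Ca] := pselect (C a).
    exists setT; first exact: (@measurableT _ (g_sigma_algebraType G)).
    by rewrite setTI; apply/setIidr => x /= ->.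
  exists set0; first exact: sigma_algebra0.
  by rewrite set0I; apply/seteqP; split => // x [/= /[swap] ->].
Qed.

(** Tracing turns a test event inside [A = a] into an event of [<<s G>>] cut by [A = a]. Over such a
    set conditional independence cancels the noise, so [EZ] and [m] have the same integral. *)
Lemma condexp_given_events (obs EZ m eps : T -> R) (a : V) :
  is_condexp P <<s G `|` events_of A>> obs EZ ->
  is_condexp P <<s G>> eps (cst 0) ->
  adapted G m ->
  adapted [set E `&` B | E in <<s Y>> & B in <<s G>>] eps ->
  (forall x, A x = a -> obs x = m x + eps x) ->
  {ae P, forall x, A x = a -> EZ x = m x}.
Proof.
move=> [aEZ _ intEZ] [_ [C [GC CT iC]] int_eps] am aeps obsE.
set F := A @^-1` [set a].
have HF : events_of A F by exists [set a].
have mF : measurable F by exact: Am.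
have GAm : G `|` events_of A `<=` measurable by rewrite subUset.
have sGA : <<s G>> `<=` <<s G `|` events_of A>>.
  apply: smallest_sub; first exact: smallest_sigma_algebra.
  by move=> K GK; apply: sub_sigma_algebra; left.
have sF : <<s G `|` events_of A>> F by apply: sub_sigma_algebra; right.
(* No moment of [m] is assumed. Its bound on [M l] and the integrability of [eps] on [C k] make the
   integrals finite, and the pieces cover the space. *)
pose M (l : nat) := (fun x => `|m x|) @^-1` `[0, l%:R]%classic.
have GM l : <<s G>> (M l).
  apply: (adaptedP _ _).1; last exact: measurable_itv.
  exact: measurableT_comp am.
suff : {ae P, forall x k l, (C k `&` M l `&` F) x -> EZ x - m x = 0}.
  apply: filterS => x /= + Ax.
  have [k _ Ck] : (\bigcup_k C k) x by rewrite CT.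
  move=> /(_ k (Num.truncn `|m x|).+1) h; apply: subr0_eq; apply: h.
  split=> //; split=> //; rewrite /M /= in_itv /= normr_ge0 /=.
  exact/ltW/truncnS_gt.
apply: ae_foralln => k; apply: ae_foralln => l.
have GCM : <<s G>> (C k `&` M l) by exact: g_sigmaI.
have mCM : measurable (C k `&` M l) by exact: g_sigma_sub_measurable GCM.
have im : P.-integrable (C k `&` M l) (EFin \o m).
  apply: le_integrable (finite_measure_integrable_cst P l%:R mCM) => //.
    by apply/measurable_EFinP; apply: measurable_funTS; exact: adapted_measurable am.
  by move=> x [_]; rewrite /M /= in_itv /= lee_fin => /andP[_];
    rewrite (ger0_norm (ler0n _ _)).
have ieps : P.-integrable (C k `&` M l) (EFin \o eps).
  apply: integrableS (iC k) => //.
  exact: g_sigma_sub_measurable (GC k).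
have iobs : P.-integrable (C k `&` M l `&` F) (EFin \o obs).
  have mCMF : measurable (C k `&` M l `&` F) by exact: measurableI.
  have imF : P.-integrable (C k `&` M l `&` F) (EFin \o m) by exact: integrableS im.
  have iepsF : P.-integrable (C k `&` M l `&` F) (EFin \o eps).
    exact: integrableS ieps.
  apply: eq_integrable (integrableD mCMF imF iepsF) => // x.
  by move=> /set_mem[_ Fx] /=; rewrite obsE.
have sCMF : <<s G `|` events_of A>> (C k `&` M l `&` F).
  by apply: g_sigmaI => //; exact: sGA.
have mCMF : measurable (C k `&` M l `&` F) by exact: measurableI.
have [iEZ _] := intEZ _ sCMF iobs.
apply: (adapted_int_eq0_ae GAm sCMF).
- by apply: integrable_subr => //; apply: integrableS im.
- apply: measurable_funB; first exact/adaptedP.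
  by apply/adaptedP => D mD; apply: sGA; exact: (adaptedP _ _).1.
move=> H sH HS.
have mH : measurable H by exact: g_sigma_sub_measurable sH.
apply/integral_subr_eq0 => //.
- exact: integrableS iEZ.
- by apply: integrableS im => // x /HS[].
have [|_ ->] := intEZ H sH; first exact: integrableS iobs.
have [B GB HB] := g_sigma_trace a sH.
pose K := B `&` (C k `&` M l).
have GK : <<s G>> K by exact: g_sigmaI.
have mK : measurable K by exact: g_sigma_sub_measurable GK.
have HK : H = K `&` F.
  rewrite /K setIAC -HB setIAC -setIA; apply/esym/setIidl => //.
rewrite [LHS](eq_integral (fun x => (m x)%:E + (eps x)%:E)%E); last first.
  by move=> x /set_mem/HS[_ Fx] /=; rewrite -EFinD obsE.
rewrite integralD//; last 2 first.
- by apply: integrableS im => // x /HS[].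
- by apply: integrableS ieps => // x /HS[].
rewrite -[RHS]adde0; congr (_ + _)%E.
rewrite HK; apply: (cond_indep_integral_eq0 Gm Ym Am indep) => //.
  by apply: integrableS ieps => // x [].
move=> K' GK' K'K.
have [|_ <-] := int_eps K' GK'; last by rewrite integral0.
apply: integrableS ieps => //; first exact: g_sigma_sub_measurable GK'.
by move=> x /K'K[].
Qed.

End conditional_expectation.

(** * The conditional mean of the observations *)

Section network.
Context d (Om : measurableType d) (R : realType) (P : probability Om R).

Lemma preimages_measurable (I : Type) (X : I -> {RV P >-> R}) :
  preimages (fun i => X i : Om -> R) `<=` measurable.
Proof.
by move=> _ [i _ [C mC <-]]; rewrite setTI; exact: measurable_funPTI.
Qed.

Lemma preimages_adapted (I : Type) (X : I -> {RV P >-> R}) (G : set (set Om)) i :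
  preimages (fun i => X i : Om -> R) `<=` G -> adapted G (X i).
Proof.
move=> XG; apply/adaptedP => C mC; apply: sub_sigma_algebra; apply: XG.
by exists i => //; exists C => //; rewrite setTI.
Qed.

Context (N D S r : nat) (e : rel 'I_N).
Variables (u : 'I_N * 'I_N * 'I_r -> {RV P >-> R})
  (w : 'I_S * 'I_D * 'I_r -> {RV P >-> R}).

Definition mean_outcome (t : 'I_S) (i : 'I_N) (a : 'I_N -> 'I_D) (om : Om) : R :=
  \sum_(j in nbhd e i) \sum_(l < r) u (j, i, l) om * w (t, a j, l) om.

Lemma mean_outcome_adapted t i a : adapted (gen_LF u w) (mean_outcome t i a).
Proof.
rewrite /adapted /mean_outcome; under eq_fun do rewrite -big_enum.
apply: measurable_sum => j; apply: measurable_sum => l.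
apply: measurable_funM; apply: preimages_adapted; [exact: subsetUl|exact: subsetUr].
Qed.

Lemma condexp_observed (Y eps : 'cV['I_D]_N * 'I_S * 'I_N -> {RV P >-> R})
    (A : Om -> 'M['I_D]_(N, S)) (EZ : Om -> 'M[R]_(S, N)) :
  network_latent_factor_model e u w Y eps ->
  events_of A `<=` measurable ->
  cond_indep P <<s gen_LF u w >> <<s preimages (fun i => Y i : Om -> R) >>
    (events_of A) ->
  (forall t i, is_condexp P <<s gen_LF u w `|` events_of A >>
     (fun om => observed Y A om t i) (fun om => EZ om t i)) ->
  {ae P, forall om t i, EZ om t i = mean_outcome t i (fun j => A om j t) om}.
Proof.
move=> [YE _ eps0] Am indep hEZ.
have LFm : gen_LF u w `<=` measurable.
  by rewrite subUset; split; exact: preimages_measurable.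
have Ym := @preimages_measurable _ Y.
(* [A] takes finitely many values, so one null set per triple [(t, i, a)] suffices. *)
suff : {ae P, forall om t i a, A om = a ->
    EZ om t i = mean_outcome t i (fun j => a j t) om}.
  by apply: filterS => om h t i; exact: h.
apply: filter_forall => t; apply: filter_forall => i; apply: filter_forall => a.
apply: (condexp_given_events LFm Ym Am indep (hEZ t i) (eps0 (col t a) t i)).
- exact: mean_outcome_adapted.
(* As an outcome minus a mean measurable for the latent factors, the noise is measurable for the
   join of the two sigma-algebras. *)
- have epsE : (eps (col t a, t, i) : Om -> R) =
      (fun om => Y (col t a, t, i) om - mean_outcome t i (fun j => a j t) om).
    apply/funext => om; rewrite YE addrAC /mean_outcome.
    under eq_bigr do under eq_bigr do rewrite mxE.
    by rewrite subrr add0r.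
  rewrite epsE; apply: measurable_funB.
    apply/adaptedP => C mC; apply: sub_sigma_algebra.
    exists ((Y (col t a, t, i) : Om -> R) @^-1` C).
      by apply: (adaptedP _ _).1 => //; exact: preimages_adapted.
    exists setT; last by rewrite setIT.
    exact: (@measurableT _ (g_sigma_algebraType (gen_LF u w))).
  apply/adaptedP => C mC; apply: sub_sigma_algebra.
  exists setT.
    exact: (@measurableT _ (g_sigma_algebraType (preimages (fun i => Y i : Om -> R)))).
  exists (mean_outcome t i (fun j => a j t) @^-1` C); last by rewrite setTI.
  by apply: (adaptedP _ _).1 => //; exact: mean_outcome_adapted.
- move=> om Aa; rewrite mxE YE Aa /mean_outcome.
  by under eq_bigr do under eq_bigr do rewrite mxE.
Qed.

End network.

(** * Determinants of independent atomless variables *)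

Section independence.
Context d (Om : measurableType d) (R : realType) (P : probability Om R).

(** Independence makes the law of [(V, X)] a product measure, which integrates the null sections. *)
Lemma indep_sections_null d' (T' : measurableType d') (V : Om -> T')
    (X : {RV P >-> R}) (Z : set (T' * R)) :
  measurable_fun setT V -> measurable Z ->
  (forall A C, measurable A -> measurable C ->
     P (V @^-1` A `&` X @^-1` C) = (P (V @^-1` A) * P (X @^-1` C))%E) ->
  (forall v, P (X @^-1` (xsection Z v)) = 0%E) ->
  P ((fun om => (V om, X om)) @^-1` Z) = 0%E.
Proof.
move=> mV mZ ind Z0.
pose V' : {mfun Om >-> T'} := mfun_Sub (mem_set mV).
have mVX : measurable_fun setT (fun om => (V om, X om)).
  exact: measurable_fun_pair.
pose VX : {mfun Om >-> (T' * R)%type} := mfun_Sub (mem_set mVX).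
transitivity (distribution P VX Z) => //.
rewrite -(@product_measure_unique _ _ _ _ _ (distribution P V') (distribution P X))//.
by rewrite /= /product_measure1 integral0_eq// => v _; exact: Z0.
Qed.

Context (I : finType) (X : I -> {RV P >-> R}).
Hypothesis indX : mutual_indep X.

Definition gen_sub (J : {set I}) :=
  preimages (fun j : {j | j \in J} => X (val j) : Om -> R).

Lemma gen_sub_adapted (J : {set I}) i : i \in J -> adapted (gen_sub J) (X i).
Proof.
move=> iJ; pose XJ (j : {j | j \in J}) := X (val j).
by apply: (@preimages_adapted _ _ _ _ _ XJ _ (exist _ i iJ)).
Qed.

(** Cylinders over [J] form a pi-system generating [<<s gen_sub J>>], and mutual independence
    factorizes directly on them. *)
Lemma mutual_indep_gen_sub (J : {set I}) i (C : set R) H :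
  i \notin J -> measurable C -> <<s gen_sub J>> H ->
  P (H `&` X i @^-1` C) = (P H * P (X i @^-1` C))%E.
Proof.
move=> iJ mC sH.
have mX j D : measurable D -> measurable (X j @^-1` D) by exact: measurable_funPTI.
pose Pi := [set H | exists2 D : I -> set R, (forall j, measurable (D j)) &
  H = \bigcap_(j in [set` J]) X j @^-1` D j].
have mPi : Pi `<=` measurable.
  by move=> _ [D mD ->]; apply: fin_bigcap_measurable => // j _; exact: mX.
have PiI : setI_closed Pi.
  move=> _ _ [D mD ->] [D' mD' ->]; exists (fun j => D j `&` D' j).
    by move=> j; exact: measurableI.
  by rewrite -bigcapI.
have {}sH : <<s Pi>> H.
  move: H sH; apply: smallest_sub; first exact: smallest_sigma_algebra.
  move=> _ [[j jJ] _ [D mD <-]]; apply: sub_sigma_algebra.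
  exists (fun k => if k == j then D else setT).
    by move=> k; case: ifP.
  rewrite setTI; apply/seteqP; split => om /=.
    by move=> Dj k _ /=; case: eqP => // ->.
  by move=> /(_ j jJ) /=; rewrite eqxx.
set F := X i @^-1` C.
have mF : measurable F by exact: mX.
have iF : P.-integrable setT (EFin \o \1_F) by exact: integrable_indic.
have ic : P.-integrable setT (EFin \o cst (fine (P F))).
  exact: finite_measure_integrable_cst.
have iXc : P.-integrable setT (EFin \o (fun x => \1_F x - fine (P F))).
  exact: integrable_subr.
(* Factorization over [K] is recast as a vanishing integral, so that the pi-lambda lemma applies. *)
have key K : measurable K -> P (K `&` F) = (P K * P F)%E <->
    (\int[P]_(x in K) (\1_F x - fine (P F))%:E = 0)%E.
  move=> mK; rewrite -integral_subr_eq0//; last 2 first.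
  - exact: integrableS iF.
  - exact: integrableS ic.
  rewrite integral_indic// integral_cst//= fineK ?fin_num_measure//.
  by rewrite setIC (muleC (P F)).
have mH := g_sigma_sub_measurable mPi sH.
apply/key => //; apply: (integral_eq0_g_sigma mPi PiI) => //.
  by apply/key => //; rewrite setTI probability_setT mul1e.
move=> _ [D mD ->]; apply/key.
  by apply: fin_bigcap_measurable => // j _; exact: mX.
(* Putting [C] at the fresh index [i] makes the intersection a cylinder over [i |: J]. *)
pose D' j := if j == i then C else D j.
have mD' j : measurable (D' j) by rewrite /D'; case: ifP.
have D'J j : j \in J -> D' j = D j.
  by rewrite /D'; case: eqP => // -> iJ'; rewrite iJ' in iJ.
transitivity (P (\bigcap_(j in [set` (i |: J)%SET]) X j @^-1` D' j)).
  congr (P _); apply/seteqP; split => [om [DJ Fi] j /=|om DJ].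
    rewrite in_setU1 => /orP[/eqP->|jJ]; first by rewrite /D' eqxx.
    by rewrite D'J//; exact: DJ.
  split=> [j jJ|].
    by rewrite -(D'J j jJ); apply: DJ; rewrite /= in_setU1 (jJ : j \in J) orbT.
  by have := DJ i; rewrite /D' eqxx; apply; rewrite /= in_setU1 eqxx.
rewrite indX// big_setU1//= /D' eqxx muleC indX//; congr (_ * _)%E.
by apply: eq_bigr => j jJ; have := D'J j jJ; rewrite /D' => ->.
Qed.

Lemma adapted_det (G : set (set Om)) k (M : 'I_k -> 'I_k -> Om -> R) :
  (forall i j, adapted G (M i j)) ->
  adapted G (fun om => \det (\matrix_(i, j) M i j om)).
Proof.
move=> aM; rewrite /adapted /determinant.
apply: measurable_sum => s; apply: measurable_funM => //.
under eq_fun do under eq_bigr do rewrite mxE.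
by apply: measurable_prod => i _; exact: aM.
Qed.


Hypothesis atomless : forall i x, P (X i @^-1` [set x]) = 0%E.

(* Phrased with the pair (c, b), to avoid the measurability of [- b / c]. *)
Lemma affine_neq0_ae (J : {set I}) i (c b : Om -> R) : i \notin J ->
  adapted (gen_sub J) c -> adapted (gen_sub J) b ->
  {ae P, forall om, c om != 0 -> X i om * c om + b om != 0}.
Proof.
move=> iJ ac ab.
have Jm : gen_sub J `<=` measurable by exact: preimages_measurable.
pose V om := (c om, b om).
have aV : measurable_fun [set: g_sigma_algebraType (gen_sub J)] V.
  exact: measurable_fun_pair.
have mV : measurable_fun [set: Om] V.
  move=> mT A mA; apply: (g_sigma_sub_measurable Jm); exact: aV.
(* The bad set: its section at [(c, b)] is empty when [c = 0] and otherwise the single point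
   [- b / c], which is null for [X i]. *)
pose Z := [set z : (R * R) * R | z.1.1 != 0] `&` [set z | z.2 * z.1.1 + z.1.2 == 0].
have mZ : measurable Z.
  apply: measurableI.
  - rewrite (_ : [set _ | _] = (fun z : (R * R) * R => z.1.1) @^-1` (~` [set 0])).
      rewrite -[X in measurable X]setTI.
      have m11 : measurable_fun setT (fun z : (R * R) * R => z.1.1).
        exact: measurableT_comp.
      by apply: m11 => //; exact: measurableC.
    by apply/seteqP; split => z /= /eqP.
  - rewrite (_ : [set _ | _] =
        (fun z : (R * R) * R => z.2 * z.1.1 + z.1.2) @^-1` [set 0]).
      have mf : measurable_fun setT (fun z : (R * R) * R => z.2 * z.1.1 + z.1.2).
        apply: measurable_funD; last exact: measurableT_comp.
        by apply: measurable_funM => //; exact: measurableT_comp.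
      by rewrite -[X in measurable X]setTI; apply: mf.
    by apply/seteqP; split => z /= /eqP.
have Z0 : P ((fun om => (V om, X i om)) @^-1` Z) = 0%E.
  apply: indep_sections_null => //.
    move=> A C mA mC; apply: (mutual_indep_gen_sub iJ) => //.
    by rewrite -[X in <<s _>> X]setTI; exact: aV.
  move=> [v1 v2]; have [v10|v10] := eqVneq v1 0.
    rewrite (_ : xsection Z (v1, v2) = set0) ?preimage_set0 ?measure0//.
    by apply/seteqP; split => // x /xsectionP[/=]; rewrite v10 eqxx.
  apply: (subset_measure0 _ _ _ (atomless i (- v2 / v1))).
  - apply: measurable_funPTI; exact: measurable_xsection.
  - exact: measurable_funPTI.
  - move=> om /xsectionP[/= _ /eqP]; rewrite /preimage /= => /eqP.
    by rewrite addr_eq0 => /eqP <-; rewrite mulfK.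
exists ((fun om => (V om, X i om)) @^-1` Z); split => //.
- rewrite -[X in measurable X]setTI.
  have : measurable_fun setT (fun om => (V om, X i om)) by exact: measurable_fun_pair.
  by apply.
- move=> om /= /not_implyP[c0 /negP]; rewrite negbK => e0.
  by split.
Qed.

Lemma det_neq0_ae k (f : 'I_k -> 'I_k -> I) :
  (forall i j i' j', f i j = f i' j' -> i = i' /\ j = j') ->
  {ae P, forall om, \det (\matrix_(i, j) X (f i j) om) != 0}.
Proof.
elim: k f => [|k IHk] f f_inj.
  by apply: aeW => om; rewrite det_mx00 oner_eq0.
(* [J] omits only the index of entry (0, 0). The cofactors along the first row and the other entries
   of that row depend on [J] alone. *)
pose J := [set i | i != f ord0 ord0]%SET.
pose M om := \matrix_(i, j) X (f i j) om.
have aX i j : (i != ord0) || (j != ord0) -> adapted (gen_sub J) (X (f i j)).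
  move=> ij; have fJ : f i j \in J.
    rewrite inE; apply: contraL ij => /eqP/f_inj[-> ->].
    by rewrite eqxx.
  exact: gen_sub_adapted.
have cofE om j : cofactor (M om) ord0 j = (-1) ^+ j *
    \det (\matrix_(i', j') X (f (lift ord0 i') (lift j j')) om).
  rewrite /cofactor add0n; congr (_ * \det _).
  by apply/matrixP => i' j'; rewrite !mxE.
have acof j : adapted (gen_sub J) (fun om => cofactor (M om) ord0 j).
  under eq_fun do rewrite cofE.
  apply: measurable_funM => //; apply: adapted_det => i' j'.
  by apply: aX; rewrite eq_sym neq_lift.
have fJ : f ord0 ord0 \notin J by rewrite inE negbK.
pose b om := \sum_(j < k) M om ord0 (lift ord0 j) * cofactor (M om) ord0 (lift ord0 j).
have ab : adapted (gen_sub J) b.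
  apply: measurable_sum => j; apply: measurable_funM; last exact: acof.
  under eq_fun do rewrite mxE.
  exact: aX.
(* Laplace expansion along the first row: the determinant is affine in the entry
   (0, 0), with slope a minor that is nonzero by induction. *)
have := affine_neq0_ae fJ (acof ord0) ab.
have : {ae P, forall om,
    \det (\matrix_(i, j) X (f (lift ord0 i) (lift ord0 j)) om) != 0}.
  by apply: IHk => i j i' j' /f_inj[/lift_inj -> /lift_inj ->].
apply: filterS2 => om; rewrite (expand_det_row _ ord0) big_ord_recl -/(M om).
rewrite cofE expr0 mul1r [M om ord0 ord0]mxE => c0; exact.
Qed.

End independence.

(** * Span of the training measurements *)

Section linear_algebra.
Context (R : realType) (N D Ttr r : nat).
Implicit Types (A : 'M['I_D]_(N, Ttr)) (atilde : 'cV['I_D]_N) (K : {set 'I_N}).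

(** Equal row lists match the two sequences position by position; [uniq l] lets [index] recover the
    position. *)
Lemma sum_rows_of m (A B : 'M['I_D]_(N, m)) (s l : seq 'I_N) (x0 : 'I_N)
    (F : 'I_N -> 'I_D -> R) (t : 'I_m) :
  uniq l -> rows_of A s = rows_of B l ->
  \sum_(j <- s) F j (A j t) = \sum_(k <- l) F (nth x0 s (index k l)) (B k t).
Proof.
move=> ul AB.
have sz : size s = size l by have := congr1 size AB; rewrite !size_map.
rewrite (big_nth x0) [RHS](big_nth x0) sz big_nat [RHS]big_nat.
apply: eq_bigr => i /= il; rewrite index_uniq//.
have := congr1 (fun M => nth (row x0 A) M i) AB.
rewrite (nth_map x0) ?sz// (nth_map x0)// => /rowP/(_ t).
by rewrite !mxE => ->.
Qed.

(** [phi] follows the donor permutation. It is chosen before [F], hence serves training and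
    prediction with any factors. *)
Lemma donor_reindex (e : rel 'I_N) A (apr atilde : 'cV['I_D]_N) (n i : 'I_N) :
  i \in donors e A apr atilde n -> exists phi : 'I_N -> 'I_N,
    forall F : 'I_N -> 'I_D -> R,
    (forall t, \sum_(j in nbhd e i) F j (A j t) =
               \sum_(k in nbhd e n) F (phi k) (A k t)) /\
    \sum_(j in nbhd e i) F j (apr j ord0) =
      \sum_(k in nbhd e n) F (phi k) (atilde k ord0).
Proof.
rewrite inE => /and3P[_ _ /hasP[s]]; rewrite mem_permutations => si.
move=> /andP[/eqP sA /eqP sapr].
(* The default [n] is never read in the sums: both lists have the same length and [k] lies in the
   second. *)
exists (fun k => nth n s (index k (enum (nbhd e n)))) => F.
have sumE (G : 'I_N -> R) : \sum_(j in nbhd e i) G j = \sum_(j <- s) G j.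
  by rewrite -big_enum (perm_big _ si).
rewrite sumE -[X in _ /\ _ = X]big_enum; split=> [t|].
  by rewrite sumE -[RHS]big_enum; apply: sum_rows_of => //; exact: enum_uniq.
by apply: sum_rows_of => //; exact: enum_uniq.
Qed.

(** The inner product of the stacked unit factors with [(v_{a_k})_k]. Keeping [v] free covers
    training, target and auxiliary factors. *)
Definition response K (a : 'I_N -> 'I_D) (v : 'I_D -> 'I_r -> R)
  (U : 'I_N -> 'I_r -> R) : R := \sum_(k in K) \sum_(l < r) U k l * v (a k) l.

Variable W : 'I_Ttr -> 'I_D -> 'I_r -> R.

(** When [c] enumerates all pairs, row [i] is the stacked vector [(w_b)_b] of measurement [g i], a
    point of R^{rD}. *)
Definition factor_mx k (g : 'I_k -> 'I_Ttr) (c : 'I_k -> 'I_D * 'I_r) : 'M[R]_k :=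
  \matrix_(i, j) W (g i) (c j).1 (c j).2.

Local Notation k := #|{: 'I_D * 'I_r}|.

(** Finite functions [g] make this a finite conjunction, through which almost sureness passes. *)
Definition generic_factors :=
  forall g : {ffun 'I_k -> 'I_Ttr}, injective g ->
    \det (factor_mx g (fun j => enum_val j)) != 0.

(* Functionals of the unit factors [U]: the coefficients [lam] must not depend on
   [U], which varies with the donor. *)
Definition in_training_span A K (L : ('I_N -> 'I_r -> R) -> R) :=
  exists lam : 'I_Ttr -> R,
    forall U, L U = \sum_s lam s * response K (fun j => A j s) (W s) U.

Lemma in_training_span_sum A K (Z : finType) (L : Z -> ('I_N -> 'I_r -> R) -> R) :
  (forall z, in_training_span A K (L z)) ->
  in_training_span A K (fun U => \sum_z L z U).
Proof.
move=> /choice[lam lamE]; exists (fun s => \sum_z lam z s) => U.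
under eq_bigr do rewrite lamE.
rewrite exchange_big /=; apply: eq_bigr => s _.
by rewrite mulr_suml.
Qed.

(** The factor vectors of rD measurements sharing the pattern form a basis of R^{rD}. Expanding [v]
    in it leaves the treatments fixed, so the expansion carries over to responses. *)
Lemma repeated_pattern_span A K (t : 'I_Ttr) (v : 'I_D -> 'I_r -> R) :
  generic_factors ->
  (r * D <= #|[set s : 'I_Ttr | col s (sub_rows K A) == col t (sub_rows K A)]%SET|)%N ->
  in_training_span A K (response K (fun j => A j t) v).
Proof.
move=> genW; set S := [set s | _]%SET => rDS.
have kS : (k <= #|S|)%N by rewrite card_prod !card_ord mulnC.
pose g := [ffun h : 'I_k => enum_val (widen_ord kS h)].
have g_inj : injective g.
  by move=> h h'; rewrite !ffunE => /enum_val_inj/(congr1 val)/= /val_inj.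
have gS h : g h \in S by rewrite ffunE enum_valP.
have gA h j : j \in K -> A j (g h) = A j t.
  move=> jK; have := gS h; rewrite inE => /eqP/colP/(_ (enum_rank_in jK j)).
  by rewrite !mxE !enum_rankK_in.
have /(_ g g_inj) := genW; rewrite -unitfE -unitmxE => M_unit.
set M := factor_mx _ _ in M_unit.
pose x := (\row_j v (enum_val j).1 (enum_val j).2 : 'rV_k) *m invmx M.
have xE b l : v b l = \sum_h x ord0 h * W (g h) b l.
  have : x *m M = \row_j v (enum_val j).1 (enum_val j).2 by rewrite mulmxKV.
  move=> /rowP/(_ (enum_rank (b, l))); rewrite !mxE enum_rankK /= => <-.
  by apply: eq_bigr => h _; rewrite !mxE enum_rankK.
(* Coefficients move from positions [h] to measurements; a measurement outside the image of [g] gets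
   an empty sum. *)
exists (fun s => \sum_(h | g h == s) x ord0 h) => U.
transitivity (\sum_h x ord0 h * response K (fun j => A j (g h)) (W (g h)) U).
  rewrite /response; under [RHS]eq_bigr do rewrite mulr_sumr.
  rewrite [RHS]exchange_big; apply: eq_bigr => j jK.
  under [RHS]eq_bigr do rewrite mulr_sumr.
  rewrite [RHS]exchange_big; apply: eq_bigr => l _.
  rewrite xE mulr_sumr; apply: eq_bigr => h _.
  by rewrite gA// mulrCA.
rewrite (partition_big g xpredT)//=; apply: eq_bigr => s _.
by rewrite mulr_suml; apply: eq_bigr => h /eqP <-.
Qed.

Lemma test_target_span (e : rel 'I_N) A atilde (n : 'I_N) (v : 'I_D -> 'I_r -> R) :
  generic_factors -> training_treatment_test R r e A atilde n ->
  in_training_span A (nbhd e n) (response (nbhd e n) (fun j => atilde j ord0) v).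
Proof.
move=> genW /andP[/submxP[C CE] /forallP rep]; set K := nbhd e n in CE rep *.
(* [z] runs over the columns of [Btr], that is, over pairs of a treatment [bz z] and a measurement
   [sz z]. *)
have [Z [c [bz [sz cE]]]] : exists (Z : finType) (c : 'I_D -> Z -> R)
    (bz : Z -> 'I_D) (sz : Z -> 'I_Ttr), forall k b, k \in K ->
    (atilde k ord0 == b)%:R = \sum_z c b z * (A k (sz z) == bz z)%:R.
  exists 'I_(\sum_(b < D) Ttr), (fun b z => C b z).
  exists (fun z => tagnat.sig1 z), (fun z => tagnat.sig2 z) => k b kK.
  have /matrixP/(_ b (enum_rank_in kK k)) := CE.
  rewrite !mxE enum_rankK_in// => ->.
  by apply: eq_bigr => z _; rewrite !mxE enum_rankK_in.
(* Expanding [v] at the target treatment through the indicators and collecting by column leaves, for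
   column [z], the function [q z] of [A k (sz z)]. *)
pose q z b l := (b == bz z)%:R * \sum_b' c b' z * v b' l.
have /in_training_span_sum : forall z,
    in_training_span A K (response K (fun j => A j (sz z)) (q z)).
  by move=> z; exact: repeated_pattern_span.
move=> [lam lamE]; exists lam => U; rewrite -lamE /response.
rewrite [RHS]exchange_big /=; apply: eq_bigr => k kK.
rewrite [RHS]exchange_big /=; apply: eq_bigr => l _.
rewrite -mulr_sumr; congr (_ * _).
transitivity (\sum_b (atilde k ord0 == b)%:R * v b l).
  rewrite (bigD1 (atilde k ord0))//= eqxx mul1r big1 ?addr0// => b.
  by rewrite eq_sym => /negbTE ->; rewrite mul0r.
under eq_bigr do rewrite cE// mulr_suml.
rewrite exchange_big /=; apply: eq_bigr => z _.
by rewrite /q mulr_sumr; apply: eq_bigr => b _; rewrite mulrAC mulrC.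
Qed.

End linear_algebra.

(** * Almost sure genericity of the training factors *)

Section generic.
Context d (Om : measurableType d) (R : realType) (P : probability Om R).

(** An injective [g] gives distinct measurements in distinct rows, and columns are distinct pairs
    [(b, l)], so the entries are distinct variables. *)
Lemma generic_factors_ae (D Ttr Tpr r : nat)
    (w : 'I_(Ttr + Tpr) * 'I_D * 'I_r -> {RV P >-> R}) :
  mutual_indep w -> (forall i x, P (w i @^-1` [set x]) = 0%E) ->
  {ae P, forall om, generic_factors (fun t b l => w (lshift Tpr t, b, l) om)}.
Proof.
move=> indw w0; apply: filter_forall => g.
have [g_inj|g_ninj] := pselect (injective g); last by apply: aeW => om /g_ninj.
pose f (i j : 'I_#|{: 'I_D * 'I_r}|) :=
  (lshift Tpr (g i), (enum_val j).1, (enum_val j).2).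
have f_inj i j i' j' : f i j = f i' j' -> i = i' /\ j = j'.
  move=> [/val_inj/g_inj -> j1 j2]; split=> //.
  by apply: enum_val_inj; rewrite [LHS]surjective_pairing j1 j2 -surjective_pairing.
by have := det_neq0_ae indw w0 f_inj; apply: filterS => om /= + _.
Qed.

End generic.

(** * The rowspace inclusion *)

Theorem proposition2
  (R : realType) (d : measure_display) (Om : measurableType d)
  (P : probability Om R)
  (N D Ttr Tpr r rbar : nat)
  (e : rel 'I_N) (e_sym : symmetric e) (e_refl : reflexive e)
  (u : 'I_N * 'I_N * 'I_r -> {RV P >-> R})
  (w : 'I_(Ttr + Tpr) * 'I_D * 'I_r -> {RV P >-> R})
  (Y eps : 'cV['I_D]_N * 'I_(Ttr + Tpr) * 'I_N -> {RV P >-> R})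
  (A : Om -> 'M['I_D]_(N, Ttr + Tpr)) (apr : Om -> 'cV['I_D]_N)
  (hmodel : network_latent_factor_model e u w Y eps)
  (A_meas : events_of A `<=` measurable)
  (A_pr : forall om (t : 'I_Tpr), col (rshift Ttr t) (A om) = apr om)
  (Y_indep_A : cond_indep P <<s gen_LF u w >>
     <<s preimages (fun i => Y i : Om -> R) >> (events_of A))
  (rbar_gt0 : (0 < rbar)%N) (rbarE : rbar = r)
  (pu pw : probability R R)
  (u_iid : iid u pu) (w_iid : iid w pw)
  (pu_cont : continuous_law pu) (pw_cont : continuous_law pw)
  (u_nondeg : forall k n : 'I_N,
     nondegenerate_vector P (fun om => \row_(l < r) u (k, n, l) om))
  (w_nondeg : forall (t : 'I_(Ttr + Tpr)) (a : 'I_D),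
     nondegenerate_vector P (fun om => \row_(l < r) w (t, a, l) om))
  (EZ : Om -> 'M[R]_(Ttr + Tpr, N))
  (hEZ : forall t i, is_condexp P <<s gen_LF u w `|` events_of A >>
     (fun om => observed Y A om t i) (fun om => EZ om t i))
  (n : 'I_N) (atilde : 'cV['I_D]_N) :
  {ae P, forall om,
    training_treatment_test R rbar e (lsubmx (A om)) atilde n ->
    let I := donors e (lsubmx (A om)) (apr om) atilde n in
    (sub_cols I (dsubmx (EZ om)) <= sub_cols I (usubmx (EZ om)))%MS}.
Proof.
have w0 i x : P (w i @^-1` [set x]) = 0%E.
  by rewrite -[LHS]/(distribution P (w i) [set x]) w_iid.2.
have := generic_factors_ae w_iid.1 w0.
have := condexp_observed hmodel A_meas Y_indep_A hEZ.
apply: filterS2 => om EZE genW; rewrite rbarE => test /=.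
set I := donors _ _ _ _ _.
pose v (t : 'I_Tpr) b l := w (rshift Ttr t, b, l) om.
have tspan t := test_target_span (v t) genW test.
have /choice[lam lamE] := tspan.
(* The coefficients [lam] are fixed before the donor column [z], so one matrix serves all donors. *)
apply/submxP; exists (\matrix_(t, s) lam t s); apply/matrixP => t z.
rewrite !mxE EZE.
have [phi phiE] := donor_reindex R (enum_valP z).
set i := enum_val z in phiE *.
pose F tt (j : 'I_N) (b : 'I_D) := \sum_(l < r) u (j, i, l) om * w (tt, b, l) om.
(* Every prediction column of [A om] is [apr om], which the donor condition matches with the
   target. *)
transitivity (\sum_(k in nbhd e n) F (rshift Ttr t) (phi k) (atilde k ord0)).
  rewrite -(phiE _).2 /mean_outcome; apply: eq_bigr => j _.
  by rewrite -(A_pr om t) mxE.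
have := lamE t (fun k l => u (phi k, i, l) om).
rewrite /response => ->; apply: eq_bigr => s _; rewrite !mxE EZE.
congr (_ * _).
rewrite -[LHS]/(\sum_(k in nbhd e n) F (lshift Tpr s) (phi k) (lsubmx (A om) k s)).
rewrite -(phiE _).1 /mean_outcome; apply: eq_bigr => j _.
by rewrite mxE.
Qed.
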